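(* Let $u$ be a non-principal ultrafilter on $\omega$, let $\mathbb{I}_u$ be the associated continuum, and for $m\in\omega$ let $x_{m,u}\in\mathbb{I}_u$ be the point determined by the constant sequence with value $1-2^{-m}$. Let $L$ be the layer of $\mathbb{I}_u$ that is the supremum of the strictly increasing sequence $\langle x_{m,u}\rangle_{m\in\omega}$. Then the surjective span $\sigma^*(L)$ of $L$ is nonzero; hence the span $\sigma(\mathbb{I}_u)$ is nonzero.
   Context: A continuum is a (nonempty) compact connected Hausdorff space; a subcontinuum is a subspace that is a continuum. $\beta X$ is the Čech-Stone compactification of $X$. The continuum $\mathbb{I}_u$: let $\mathbb{I}=[0,1]$, $\mathbb{M}=\omega\times\mathbb{I}$, $\pi:\mathbb{M}\to\omega$, $\pi(n,x)=n$, with Čech-Stone extension $\beta\pi:\beta\mathbb{M}\to\beta\omega$. For $u\in\omega^*=\beta\omega\setminus\omega$ put $\mathbb{I}_u=(\beta\pi)^{-1}(u)$, which is a continuum. For a sequence $\langle x_n\rangle_{n\in\omega}$ in $\mathbb{I}$, $x_u\in\mathbb{I}_u$ is the $u$-limit in $\beta\mathbb{M}$ of $\langle (n,x_n)\rangle_{n\in\omega}$: the unique point such that $\{n:(n,x_n)\in O\}\in u$ for every neighbourhood $O$ of $x_u$ in $\beta\mathbb{M}$. The points $0_u$ and $1_u$ come from the constant sequences $0$ and $1$. Order and layers: for $x,y\in\mathbb{I}_u$, $x\le_u y$ means that every subcontinuum of $\mathbb{I}_u$ containing $0_u$ and $y$ also contains $x$. The classes of the equivalence relation ''$x\le_u y$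 and $y\le_u x$'' are called layers; they are subcontinua of $\mathbb{I}_u$ and are linearly ordered by $\le_u$. The supremum of a sequence is taken in this linearly ordered set of layers. Span: for a continuum $X$ let $\Delta(X)=\{(x,x):x\in X\}$ and let $\pi_1,\pi_2:X^2\to X$ be the projections. The span $\sigma(X)$ is nonzero if there is a subcontinuum $Z$ of $X^2$ with $\pi_1[Z]=\pi_2[Z]$ and $Z\cap\Delta(X)=\emptyset$; the surjective span $\sigma^*(X)$ is nonzero if there is a subcontinuum $Z$ of $X^2$ with $\pi_1[Z]=\pi_2[Z]=X$ and $Z\cap\Delta(X)=\emptyset$. *)

(* Defs.v *)
From HB Require Import structures.
From mathcomp Require Import all_boot all_order all_algebra.
From mathcomp Require Import all_classical all_reals all_analysis.

Set Implicit Arguments.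
Unset Strict Implicit.
Unset Printing Implicit Defensive.

Import Order.TTheory GRing.Theory Num.Theory.
Import numFieldNormedType.Exports.

Local Open Scope classical_set_scope.
Local Open Scope ring_scope.

Lemma compact_set_type (T : topologicalType) (A : set T) :
  compact A -> compact [set: set_type A].
Proof.
move=> cA F FF _.
have [|p [Ap pF]] := cA (set_val @ F) _.
  by apply: (@filterS _ F _ setT); [move=> x _; exact: set_valP|exact: filterT].
exists (exist _ p (mem_set Ap)); split=> // B V FB [_ [[W oW <-] Wp WV]].
have [||_ [[b Bb <-] Wb]] := pF (set_val @` B) W.
- by apply: (@filterS _ F _ B) FB => b Bb; exists b.
- exact: open_nbhs_nbhs.
- by exists b; split=> //; exact: WV.
Qed.

Lemma injective_hausdorff (X Y : topologicalType) (f : X -> Y) :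
  injective f -> continuous f -> hausdorff_space Y -> hausdorff_space X.
Proof.
move=> fI cf hY p q pq; apply/fI/hY => A B fpA fqB.
have [x [Ax Bx]] := pq _ _ (cf p _ fpA) (cf q _ fqB).
by exists (f x).
Qed.

Lemma hausdorff_set_type (T : topologicalType) (A : set T) :
  hausdorff_space T -> hausdorff_space (set_type A).
Proof.
apply: (@injective_hausdorff _ _ set_val); first exact: val_inj.
exact: initial_continuous.
Qed.

Lemma continuous_ptws (X Y : topologicalType) (I : Type)
    (f : X -> prod_topology (fun _ : I => Y)) :
  (forall i, continuous (fun x => f x i)) -> continuous f.
Proof.
move=> cf x; apply/cvg_sup => i.
exact: (@continuous_comp_initial (prod_topology (fun _ : I => Y)) X Y
  (fun p => p i) f (cf i) x).
Qed.

Section unit_interval.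
Variable R : realType.

Definition unit_interval : Type := set_type (`[0, 1]%classic : set R).

HB.instance Definition _ :=
  Topological.copy unit_interval (set_type (`[0, 1]%classic : set R)).

Definition unit_point (x : R) (x01 : 0 <= x <= 1) : unit_interval :=
  exist _ x (mem_set (x01 : (`[0, 1]%classic : set R) x)).

Fact unit0_subproof : 0 <= (0 : R) <= 1.
Proof. by rewrite lexx ler01. Qed.

Fact one_sub_dyadic_subproof (m : nat) : 0 <= (1 - 2 ^- m : R) <= 1.
Proof.
by rewrite subr_ge0 invf_le1 ?exprn_gt0 // exprn_ege1 ?ler1n //= gerBl invr_ge0
  exprn_ge0.
Qed.

Definition unit0 : unit_interval := unit_point unit0_subproof.

Definition one_sub_dyadic (m : nat) : unit_interval :=
  unit_point (one_sub_dyadic_subproof m).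

HB.instance Definition _ := isPointed.Build unit_interval unit0.

Lemma unit_interval_compact : compact [set: unit_interval].
Proof. exact/compact_set_type/segment_compact. Qed.

Lemma unit_interval_hausdorff : hausdorff_space unit_interval.
Proof. exact/hausdorff_set_type/Rhausdorff. Qed.

End unit_interval.

(* For a Tychonoff space X, stone_cech R X is the closure of the image of X in
   the cube [0,1]^C(X,[0,1]). *)
Section stone_cech.
Variable R : realType.
Local Notation I := (unit_interval R).

Definition cube (X : topologicalType) : Type :=
  prod_topology (fun _ : continuousType X I => I).

HB.instance Definition _ (X : topologicalType) :=
  Topological.copy (cube X) (prod_topology (fun _ : continuousType X I => I)).

Lemma cube_proj_continuous (X : topologicalType) (f : continuousType X I) :
  continuous (fun p : cube X => p f).
Proof. exact: (@proj_continuous (continuousType X I) (fun=> I) f). Qed.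

Definition evaluation (X : topologicalType) (x : X) : cube X := fun f => f x.

Lemma evaluation_continuous (X : topologicalType) : continuous (@evaluation X).
Proof. by apply: continuous_ptws => f; exact: cts_fun. Qed.

Definition stone_cech (X : topologicalType) : Type :=
  set_type (closure (range (@evaluation X))).

HB.instance Definition _ (X : topologicalType) :=
  Topological.copy (stone_cech X) (set_type (closure (range (@evaluation X)))).

Definition stone_cech_in (X : topologicalType) (x : X) : stone_cech X :=
  exist _ (evaluation x) (mem_set (subset_closure (imageT (@evaluation X) x))).

HB.instance Definition _ (X : ptopologicalType) :=
  isPointed.Build (stone_cech X) (stone_cech_in (point : X)).

Lemma stone_cech_compact (X : topologicalType) : compact [set: stone_cech X].
Proof.
apply: compact_set_type.
apply: (subclosed_compact (@closed_closure _ _) _ (@subsetT _ _)).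
have := @tychonoff (continuousType X I) (fun=> I) (fun=> setT)
  (fun=> @unit_interval_compact R).
by congr compact; apply/seteqP; split.
Qed.

Lemma stone_cech_hausdorff (X : topologicalType) :
  hausdorff_space (stone_cech X).
Proof.
apply: hausdorff_set_type.
apply: (@hausdorff_product (continuousType X I) (fun=> I)) => _.
exact: unit_interval_hausdorff.
Qed.

Lemma stone_cech_ultra_cvg (X : ptopologicalType) (S : Type) (u : set_system S)
    (f : S -> stone_cech X) :
  UltraFilter u -> cvg (f @ u).
Proof.
move=> uU; have [|p [_ up]] := @stone_cech_compact X (f @ u) _.
  exact: filterT.
apply/cvg_ex; exists p => A pA.
have [//|unA] := in_ultra_setVsetC (f @^-1` A) uU.
by have [q [nAq Aq]] := up (~` A) A unA pA.
Qed.

Lemma stone_cech_in_continuous (X : topologicalType) :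
  continuous (@stone_cech_in X).
Proof.
apply: (@continuous_comp_initial _ _ _ set_val).
exact: evaluation_continuous.
Qed.

Lemma stone_cech_in_dense (X : topologicalType) :
  closure (range (@stone_cech_in X)) = [set: stone_cech X].
Proof.
apply/seteqP; split=> // p _ B [_ [[W oW <-] Wp WB]].
have [_ [[x _ <-] Wx]] := set_valP p W (open_nbhs_nbhs (conj oW Wp)).
by exists (stone_cech_in x); split; [exists x|exact: WB].
Qed.

Lemma stone_cech_extend (X : topologicalType) (f : continuousType X I) :
  exists2 F : stone_cech X -> I, continuous F &
    forall x, F (stone_cech_in x) = f x.
Proof.
exists (fun p => set_val p f) => // p.
apply: (@continuous_comp _ (cube X) _ set_val (fun q : cube X => q f)).
  exact: initial_continuous.
exact: cube_proj_continuous.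
Qed.

Definition cube_map (X Y : topologicalType) (h : continuousType X Y)
    (p : cube X) : cube Y :=
  fun g => p (g \o h).

Lemma cube_map_continuous (X Y : topologicalType) (h : continuousType X Y) :
  continuous (cube_map h).
Proof. by apply: continuous_ptws => g; exact: cube_proj_continuous. Qed.

Fact stone_cech_map_subproof (X Y : topologicalType) (h : continuousType X Y)
    (p : stone_cech X) :
  closure (range (@evaluation Y)) (cube_map h (set_val p)).
Proof.
move=> V /cube_map_continuous /(set_valP p) [_ [[x _ <-] Vx]].
by exists (evaluation (h x)); split; [exists (h x)|].
Qed.

(* The Cech-Stone extension of h: the unique continuous map that agrees with h
   on X, by stone_cech_map_continuous, stone_cech_mapE and density of X. *)
Definition stone_cech_map (X Y : topologicalType) (h : continuousType X Y)
    (p : stone_cech X) : stone_cech Y :=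
  exist _ (cube_map h (set_val p)) (mem_set (@stone_cech_map_subproof X Y h p)).

Lemma stone_cech_map_continuous (X Y : topologicalType)
    (h : continuousType X Y) :
  continuous (stone_cech_map h).
Proof.
apply: (@continuous_comp_initial _ _ _ set_val) => p.
apply: (@continuous_comp _ (cube X) _ set_val (cube_map h)).
  exact: initial_continuous.
exact: cube_map_continuous.
Qed.

Lemma stone_cech_mapE (X Y : topologicalType) (h : continuousType X Y) (x : X) :
  stone_cech_map h (stone_cech_in x) = stone_cech_in (h x).
Proof. exact: val_inj. Qed.

End stone_cech.

Section continua.
Variable T : topologicalType.
Implicit Types A K X : set T.

Definition continuum A :=
  [/\ A !=set0, compact A, connected A & hausdorff_space (set_type A)].

Definition subcontinuum X K := K `<=` X /\ continuum K.

Definition diagonal X : set (T * T) := [set p | X p.1 /\ p.1 = p.2].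

End continua.

Section span.
Variables (T : topologicalType) (X : set T).

Definition span_nonzero := exists Z : set (T * T),
  [/\ subcontinuum (X `*` X) Z, fst @` Z = snd @` Z &
      Z `&` diagonal X = set0].

Definition surjective_span_nonzero := exists Z : set (T * T),
  [/\ subcontinuum (X `*` X) Z, fst @` Z = X, snd @` Z = X &
      Z `&` diagonal X = set0].

End span.

Section standard_subcontinuum.
Variable R : realType.
Local Notation I := (unit_interval R).

(* The space M, the topological sum of countably many copies of [0,1]. *)
Definition bigM : Type := (nat * I)%type.

HB.instance Definition _ := Topological.copy bigM (nat * I)%type.
HB.instance Definition _ := Pointed.copy bigM (nat * I)%type.

Definition bigM_proj : continuousType bigM nat :=
  mkcts (fun x => @cvg_fst _ _ (nbhs x.1) (nbhs x.2) _).

Variable u : set_system nat.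

(* The ultrafilter u, viewed as a point of the Cech-Stone compactification of
   the discrete space of natural numbers. *)
Definition ultrafilter_point : stone_cech R nat :=
  lim ((fun n : nat => stone_cech_in R n) @ u).

Definition I_u : set (stone_cech R bigM) :=
  stone_cech_map bigM_proj @^-1` [set ultrafilter_point].

Definition u_limit (x : nat -> I) : stone_cech R bigM :=
  lim ((fun n => stone_cech_in R ((n, x n) : bigM)) @ u).

Definition le_u (x y : stone_cech R bigM) :=
  forall K, subcontinuum I_u K -> K (u_limit (fun=> unit0 R)) -> K y -> K x.

Definition layer (x : stone_cech R bigM) : set (stone_cech R bigM) :=
  [set y | I_u y /\ (le_u x y /\ le_u y x)].

Definition is_layer (L : set (stone_cech R bigM)) :=
  exists2 x, I_u x & L = layer x.

Definition layer_le (A B : set (stone_cech R bigM)) :=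
  forall x y, A x -> B y -> le_u x y.

Definition is_layer_sup (A : nat -> set (stone_cech R bigM))
    (L : set (stone_cech R bigM)) :=
  [/\ is_layer L, (forall m, layer_le (A m) L) &
      forall B, is_layer B -> (forall m, layer_le (A m) B) -> layer_le L B].

End standard_subcontinuum.

Arguments ultrafilter_point R u : clear implicits.
Arguments I_u R u : clear implicits.

(* Main.v *)
(* Put t = -log2 (1 - x). The layer L consists of the cluster points in beta M of
   the filter generated by the sets that, for some m and every k, contain the part
   m < t <= k of almost every fibre. The upper bounds given by sequences with
   t(n) -> oo along u force any supremum into this set; conversely a
   subcontinuum containing 0_u and a point of this set contains every x_(k,u)
   because the points c_u cut I_u, hence it contains the whole set. The map
   x |-> (1 + x) / 2 is the translation t |-> t + 1, so its extension to beta M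
   maps L onto L; it has no fixed point there because it changes the sign of
   both cos (pi t) and sin (pi t). The graph of this map over L witnesses both
   claims. *)
Require Import Defs.
From mathcomp Require Import all_boot all_order all_algebra.
From mathcomp Require Import all_classical all_reals all_analysis.
From mathcomp Require Import ring lra.

Set Implicit Arguments.
Unset Strict Implicit.
Unset Printing Implicit Defensive.

Import Order.TTheory GRing.Theory Num.Theory.
Import numFieldNormedType.Exports.

Local Open Scope classical_set_scope.
Local Open Scope ring_scope.

(** * Ultrafilters: choice of counterexamples, nonprincipality *)

Lemma ultra_forall_exists (S T : Type) (u : set_system S) (A : S -> set T) :
  UltraFilter u -> T ->
  (\forall s \near u, forall t, A s t) \/
  exists c : S -> T, \forall s \near u, ~ A s (c s).
Proof.
move=> uU t0.
have [|uN] := in_ultra_setVsetC [set s | forall t, A s t] uU; first by left.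
(* Almost every [s] has a counterexample here; [t0] is only the default value for the remaining
   ones. *)
right; have /choice[c cP] s : exists t, (exists t', ~ A s t') -> ~ A s t.
  have [[t nAt]|nA] := pselect (exists t', ~ A s t'); first by exists t.
  by exists t0.
by exists c; apply: filterS uN => s /existsNP; exact: cP.
Qed.

(** A singleton in [u] would make [u] refine a principal ultrafilter, hence equal it by maximality;
    so the points below [M] can be removed one at a time. *)
Lemma nonprincipal_ge (u : set_system nat) :
  UltraFilter u -> (forall n, u <> principal_filter n) ->
  forall M : nat, \forall n \near u, (M <= n)%N.
Proof.
move=> uU uN; elim=> [|M IH]; first by apply: filterS filterT.
have [uM|uM] := in_ultra_setVsetC [set M] uU.
  case: (uN M); apply: (@max_filter _ _ (principal_filter_ultra M)).
  by move=> A /principal_filterP AM; apply: filterS uM => _ ->.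
apply: filterS (filterI IH uM) => n [Mn /eqP nM].
by rewrite ltn_neqAle eq_sym nM.
Qed.

(** * Cluster sets of filters in compact Hausdorff spaces *)

Section cluster.
Variable T : topologicalType.
Hypotheses (T_hausdorff : hausdorff_space T) (T_compact : compact [set: T]).

Lemma cluster_closed (F : set_system T) : closed (cluster F).
Proof. by rewrite clusterE; apply: closed_bigI => A _; exact: closed_closure. Qed.

Lemma cluster_subset_closure (F : set_system T) (A : set T) :
  F A -> cluster F `<=` closure A.
Proof. by move=> FA p Fp B; exact: Fp. Qed.

Lemma cluster_nonempty (F : set_system T) : ProperFilter F -> cluster F !=set0.
Proof. by move=> FF; have [|p [_ ?]] := T_compact FF; [exact: filterT|exists p]. Qed.

(** Otherwise the trace of [F] on the complement of [O] is proper and, by compactness, has a cluster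
    point. It also clusters [F], so it lies in the open set [O], which misses that trace. *)
Lemma cluster_open (F : set_system T) (O : set T) :
  Filter F -> open O -> cluster F `<=` O -> F O.
Proof.
move=> FF oO FO; apply: contrapT => nFO.
have FOp : ProperFilter (within (~` O) F).
  split; last exact: within_filter.
  by rewrite /within /= => h; apply: nFO; apply: filterS h => x; exact: contrapT.
have [p pF] := cluster_nonempty FOp.
have pO : O p.
  by apply: FO => A B FA; apply: pF; apply: filterS FA => x Ax _.
have [x [nOx Ox]] := pF (~` O) O (withinT _ _) (open_nbhs_nbhs (conj oO pO)).
exact: nOx.
Qed.

Lemma closed_separate (K : set T) (q : T) : closed K -> ~ K q ->
  exists O, [/\ open O, O q & closure O `&` K = set0].
Proof.
move=> cK nKq.
have [|V Vq VK] := @compact_regular T q setT T_hausdorff T_compact filterT (~` K).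
  by apply: open_nbhs_nbhs; split=> //; exact: closed_openC.
exists V°; split; [exact: open_interior|exact: nbhs_singleton (nbhs_interior Vq)|].
by apply/disjoints_subset; apply: subset_trans VK; apply: closureS; exact: interior_subset.
Qed.

Lemma cluster_cvg (F : set_system T) (p : T) :
  Filter F -> F --> p -> cluster F `<=` [set p].
Proof.
move=> FF Fp q Fq; apply/T_hausdorff => A B qA pB.
by rewrite setIC; apply: Fq => //; exact: Fp.
Qed.

End cluster.

(** The image of the cluster set is closed by compactness, so a point [q] off it has a neighbourhood
    [W] whose closure misses it; by [cluster_open] the preimage of the complement of [closure W] is
    in [F], so [q] does not cluster the image filter. *)
Lemma image_cluster (S T : topologicalType) (f : S -> T) (F : set_system S) :
  compact [set: S] -> compact [set: T] -> hausdorff_space T -> continuous f ->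
  Filter F -> f @` cluster F = cluster (f @ F).
Proof.
move=> cS cT hT cf FF; apply/seteqP; split=> [_ [p Fp <-] A B fA fpB|q qF].
  by have [x [Ax Bx]] := Fp _ _ fA (cf p _ fpB); exists (f x).
apply: contrapT => nq.
have fC : closed (f @` cluster F).
  apply: compact_closed => //; apply: continuous_compact.
    exact: continuous_subspaceT.
  exact: subclosed_compact (@cluster_closed _ F) cS _.
have [W [oW Wq WF]] := closed_separate hT cT fC nq.
have FnW : (f @ F) (~` closure W).
  apply: (cluster_open cS FF) => [|p Fp Wp].
    by apply: open_comp => [x _|]; [exact: cf|exact/closed_openC/closed_closure].
  suff : (closure W `&` f @` cluster F) (f p) by rewrite WF.
  by split=> //; exists p.
have [x [/= nx Wx]] := qF _ W FnW (open_nbhs_nbhs (conj oW Wq)).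
by apply: nx; exact: subset_closure.
Qed.

(* A separation of the cluster set would colour almost every P s with one of two
   colours, and the ultrafilter selects one of them. *)
Lemma cluster_connected (S : Type) (u : set_system S) (X T : topologicalType)
    (j : X -> T) (G : set_system X) :
  UltraFilter u -> Filter G -> continuous j ->
  hausdorff_space T -> compact [set: T] ->
  (forall F, G F -> exists P : S -> set X, [/\ forall s, connected (P s),
     forall s, P s `<=` F & forall U, u U -> G (\bigcup_(s in U) P s)]) ->
  connected (cluster (j @ G)).
Proof.
move=> uU FG cj hT cT GP B [b Bb] [W oW BW] [D cD BD].
have cC := @cluster_closed _ (j @ G).
apply/seteqP; split=> [x|p Cp]; first by rewrite BW => -[].
apply: contrapT => nBp.
have cB : closed B by rewrite BD; exact: closedI.
have oA : open (~` (cluster (j @ G) `&` ~` W)).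
  by apply: closed_openC; apply: closedI; [exact: cC|exact: open_closedC].
have [|V BV VA] :=
    @compact_normal T hT cT B cB (~` (cluster (j @ G) `&` ~` W)).
  apply/set_nbhsP; exists (~` (cluster (j @ G) `&` ~` W)); split=> //.
  by move=> x; rewrite BW => -[_ Wx] [_].
have nVp : ~ closure V p.
  by move=> /VA; apply; split=> // Wp; apply: nBp; rewrite BW.
have sep : separated V° (~` closure V).
  split; apply/disjoints_subset => x.
    by move=> Vx /=; apply; apply: (closureS (@interior_subset _ V)) Vx.
  move=> Vx /(_ V)[|y [ny Vy]]; first exact: Vx.
  by apply: ny; exact: subset_closure.
have CVW : cluster (j @ G) `<=` V° `|` ~` closure V.
  move=> x Cx; have [Wx|nWx] := pselect (W x).
    by left; apply: BV; rewrite BW.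
  by right=> /VA; apply.
have /GP[P [Pc PVW PG]] : G (j @^-1` (V° `|` ~` closure V)).
  apply: (@cluster_open _ cT (j @ G)) CVW.
  by apply: openU; [exact: open_interior|exact/closed_openC/closed_closure].
have Pone s : j @` P s `<=` V° \/ j @` P s `<=` ~` closure V.
  apply: (connected_subset sep); first by move=> _ [x Px <-]; exact: PVW Px.
  by apply: connected_continuous_connected => //; exact: continuous_subspaceT.
have [uV|uV] := in_ultra_setVsetC [set s | j @` P s `<=` V°] uU.
  apply: nVp; apply: (@cluster_subset_closure T (j @ G)) Cp.
  suff : G (j @^-1` V) by [].
  apply: filterS (PG _ uV) => x [s sV Px]; apply: (@interior_subset _ V).
  by apply: sV; exists x.
have GW : G (j @^-1` (~` closure V)).
  apply: filterS (PG _ uV) => x [s sV Px].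
  by have [//|sW] := Pone s; apply: sW; exists x.
have Cb : cluster (j @ G) b by move: Bb; rewrite BW => -[].
have [|x [nx Vx]] := @cluster_subset_closure T (j @ G) _ GW b Cb V.
  exact: BV.
by apply: nx; exact: subset_closure.
Qed.

Lemma continuous_eq_closure (S T : topologicalType) (f g : S -> T) (A : set S) :
  hausdorff_space T -> continuous f -> continuous g ->
  {in A, f =1 g} -> {in closure A, f =1 g}.
Proof.
move=> hT cf cg fg x /set_mem clx; apply: hT => V W fV gW.
have fgVW : nbhs x (f @^-1` V `&` g @^-1` W) by apply: filterI; [exact: cf|exact: cg].
have [y [Ay [/= Vy Wy]]] := clx _ fgVW.
by exists (f y); split=> //; rewrite fg // inE.
Qed.

(** * The unit interval and the sum of its copies *)

Section unit_interval_theory.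
Variable R : realType.
Local Notation I := (unit_interval R).

Definition unit_val (x : I) : R := set_val x.

Lemma unit_val_continuous : continuous unit_val.
Proof. exact: initial_continuous. Qed.

Lemma unit_val_inj : injective unit_val.
Proof. exact: val_inj. Qed.

Lemma unit_val_itv (x : I) : 0 <= unit_val x <= 1.
Proof. by have := set_valP x; rewrite /= in_itv. Qed.

Fact clamp_subproof (r : R) : 0 <= Num.max 0 (Num.min r 1) <= 1.
Proof. by rewrite le_max lexx ge_max ler01 ge_min lexx orbT. Qed.

Definition clamp (r : R) : I := unit_point (clamp_subproof r).

Lemma clampE (r : R) : 0 <= r <= 1 -> unit_val (clamp r) = r.
Proof.
by case/andP=> r0 r1; rewrite -[LHS]/(Num.max 0 (Num.min r 1)) min_l // max_r.
Qed.

Lemma unit_valK : cancel unit_val clamp.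
Proof. by move=> x; apply: unit_val_inj; rewrite clampE // unit_val_itv. Qed.

Lemma clamp_continuous : continuous clamp.
Proof.
apply: (@continuous_comp_initial _ _ _ set_val) => r.
apply: (@continuous_max R R^o (fun=> 0) (fun r => Num.min r 1)).
  exact: cst_continuous.
apply: (@continuous_min R R^o id (fun=> 1)) => //.
exact: cst_continuous.
Qed.

(** Order convexity makes the copy of [P] in [R] an interval, and the retraction [clamp] carries it
    back. *)
Lemma unit_connected (P : set I) :
  (forall x y z, P x -> P y -> unit_val x <= unit_val z <= unit_val y -> P z) ->
  connected P.
Proof.
move=> Pitv; have -> : P = clamp @` (unit_val @` P).
  rewrite image_comp (_ : clamp \o unit_val = id) ?image_id //.
  by apply/funext => x /=; rewrite unit_valK.
apply: connected_continuous_connected; last first.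
  exact/continuous_subspaceT/clamp_continuous.
apply/connected_intervalP => _ _ [x Px <-] [y Py <-] z /andP[xz zy].
have z01 : 0 <= z <= 1.
  have /andP[x0 _] := unit_val_itv x; have /andP[_ y1] := unit_val_itv y.
  by rewrite (le_trans x0) // (le_trans zy).
by exists (clamp z); rewrite ?clampE //; apply: Pitv Px Py _; rewrite clampE ?xz.
Qed.

Lemma unit_val_dyadic (m : nat) : unit_val (one_sub_dyadic R m) = 1 - 2 ^- m.
Proof. by []. Qed.

Lemma dyadic_le (m k : nat) :
  (m <= k)%N -> unit_val (one_sub_dyadic R m) <= unit_val (one_sub_dyadic R k).
Proof.
move=> mk; rewrite !unit_val_dyadic lerD2l lerN2 lef_pV2 ?posrE ?exprn_gt0 //.
by rewrite ler_eXn2l // ltr1n.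
Qed.

Lemma dyadic_lt (m k : nat) :
  (m < k)%N -> unit_val (one_sub_dyadic R m) < unit_val (one_sub_dyadic R k).
Proof.
move=> mk; rewrite !unit_val_dyadic ltrD2l ltrN2 ltf_pV2 ?posrE ?exprn_gt0 //.
by rewrite ltr_eXn2l // ltr1n.
Qed.

(** The index space is discrete, so every fibre is open. *)
Lemma bigM_continuous (T : topologicalType) (f : bigM R -> T) :
  (forall n, continuous (fun x => f (n, x))) -> continuous f.
Proof.
move=> cf [n x] A fA; exists ([set n], (fun y => f (n, y)) @^-1` A) => /=.
  by split; [apply/principal_filterP|exact: cf].
by move=> [k y] /= [-> ].
Qed.

Lemma pair_continuous (n : nat) : continuous (fun x : I => (n, x) : bigM R).
Proof.
move=> x A [[B C] /= [Bn Cx] BC]; apply: filterS Cx => y Cy.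
by apply: BC; split=> //=; exact: nbhs_singleton.
Qed.

End unit_interval_theory.

(** * Subsets of [I_u] given by families of subsets of the fibres; cut points *)

Section sections.
Variables (R : realType) (u : set_system nat).
Hypothesis u_ultra : UltraFilter u.
Local Notation I := (unit_interval R).
Local Notation M := (bigM R).
Local Notation bM := (stone_cech R M).
Local Notation inM := (@stone_cech_in R M).

(** The unions of the sets [{n} x P n] over [n] in [U], for [U] in [u], form a base; the cluster set
    in [beta M] is the intersection of their closures. *)
Definition section_filter (P : nat -> set I) : set_system M :=
  [set F | \forall n \near u, forall x, P n x -> F (n, x)].

Global Instance section_filter_filter (P : nat -> set I) :
  Filter (section_filter P).
Proof.
split; [exact: nearW| |].
  move=> F G; rewrite /section_filter /=; apply: filterS2 => n Fn Gn x Px.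
  by split; [exact: Fn|exact: Gn].
move=> F G FG; rewrite /section_filter /=; apply: filterS => n Fn x Px.
by apply: FG; exact: Fn.
Qed.

Definition section_cluster (P : nat -> set I) : set bM :=
  cluster (inM @ section_filter P).

Lemma near_section (P : nat -> set I) (A : set bM) :
  (inM @ section_filter P) A =
  (\forall n \near u, forall x, P n x -> A (inM (n, x))).
Proof. by []. Qed.

Lemma section_clusterS (P Q : nat -> set I) :
  (\forall n \near u, P n `<=` Q n) -> section_cluster P `<=` section_cluster Q.
Proof.
move=> PQ; apply: cvg_cluster => F.
by rewrite /= /section_filter /=; apply: filterS2 PQ => n PQ QF x /PQ; exact: QF.
Qed.

Lemma u_limit_cvg (x : nat -> I) :
  (fun n => inM (n, x n)) @ u --> u_limit u x.
Proof. exact: (@stone_cech_ultra_cvg R M nat u (fun n => inM (n, x n)) u_ultra). Qed.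

Lemma u_limit_section_cluster (P : nat -> set I) (x : nat -> I) :
  (\forall n \near u, P n (x n)) -> section_cluster P (u_limit u x).
Proof.
move=> Px A B PA /u_limit_cvg xB.
have [n [[Pn An] Bn]] := filter_ex (filterI (filterI Px PA) xB).
by exists (inM (n, x n)); split=> //; exact: An.
Qed.

Lemma section_clusterU (P Q : nat -> set I) :
  section_cluster (fun n => P n `|` Q n) `<=`
  section_cluster P `|` section_cluster Q.
Proof.
move=> p PQp; apply: contrapT => /not_orP[].
move=> /existsNP[A /existsNP[V /not_implyP[PA /not_implyP[Vp AV]]]].
move=> /existsNP[B /existsNP[W /not_implyP[QB /not_implyP[Wp BW]]]].
have [|x [AB [Vx Wx]]] := PQp (A `|` B) (V `&` W) _ (filterI Vp Wp).
  move: PA QB; rewrite !near_section; apply: filterS2 => n Pn Qn x.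
  by case=> [/Pn|/Qn]; [left|right].
by case: AB => [Ax|Bx]; [apply: AV|apply: BW]; exists x.
Qed.

Lemma ultrafilter_point_cvg :
  (fun n => stone_cech_in R n) @ u --> ultrafilter_point R u.
Proof. exact: (@stone_cech_ultra_cvg R nat nat u (fun n => stone_cech_in R n) u_ultra). Qed.

(** The extended projection sends a cluster point to a cluster point of the family
    [stone_cech_in R n] along [u], which can only be its limit. *)
Lemma section_cluster_I_u (P : nat -> set I) : section_cluster P `<=` I_u R u.
Proof.
move=> p Pp.
suff : cluster ((fun n => stone_cech_in R n) @ u)
    (stone_cech_map (bigM_proj R) p).
  apply: cluster_cvg; first exact: stone_cech_hausdorff.
  exact: ultrafilter_point_cvg.
move=> A B uA.
move=> /(@stone_cech_map_continuous R _ _ (bigM_proj R) p) pB.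
have [|x [/= Ax Bx]] := Pp (stone_cech_map (bigM_proj R) @^-1` A) _ _ pB.
  rewrite near_section; apply: (@filterS _ u _ (fun n => A (stone_cech_in R n))) uA.
  by move=> n An x _ /=; rewrite stone_cech_mapE.
by exists (stone_cech_map (bigM_proj R) x).
Qed.

(** Let [U] index the fibres inside [A]. The indicator of [U] extends to [beta omega] with value 1
    at [u]. If a neighbourhood [B] of [p] missed [A], then [p] would be a limit of points of fibres
    outside [U], which gives the value 0 instead. *)
Lemma I_u_section_cluster : I_u R u `<=` section_cluster (fun=> setT).
Proof.
move=> p pu A B uA pB; apply: contrapT => AB.
pose U := [set n | forall x, A (inM (n, x))].
have uU : u U.
  by move: uA; rewrite near_section; apply: filterS => n An x; exact: An.
pose chi (n : nat) := clamp (\1_U n : R).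
have cchi : continuous chi.
  by move=> n V chiV; apply/principal_filterP; exact: (nbhs_singleton chiV).
have [F cF FE'] := stone_cech_extend (mkcts cchi).
have FE n : F (stone_cech_in R n) = chi n by exact: FE'.
pose pi := stone_cech_map (R := R) (bigM_proj R).
have cFpi : continuous (F \o pi).
  by move=> q; apply: continuous_comp; [exact: stone_cech_map_continuous|exact: cF].
have Fp : F (pi p) = clamp 1.
  rewrite (pu : pi p = _).
  apply: (@unit_interval_hausdorff R) => V W FV W1.
  have uV : u (fun n => V (F (stone_cech_in R n))).
    exact: (ultrafilter_point_cvg (cF _ _ FV)).
  have [n [Un Vn]] := filter_ex (filterI uU uV).
  exists (F (stone_cech_in R n)); split=> //; rewrite FE /chi indicE.
  by rewrite mem_set //; exact: nbhs_singleton.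
have : closure (range inM `&` (B `&` ~` A)) p.
  move=> V Vp; have : closure (range inM) p by rewrite stone_cech_in_dense.
  move=> /(_ (V `&` B) (filterI Vp pB))[x [ix [Vx Bx]]]; exists x; split=> //.
  by split=> //; split=> // Ax; apply: AB; exists x.
move=> clp; have : (F \o pi) p = cst (clamp 0) p.
  apply: (continuous_eq_closure (@unit_interval_hausdorff R) cFpi _ _ (mem_set clp)).
    exact: cst_continuous.
  move=> x /set_mem [[[n y] _ <-] [_ nA]]; rewrite /= /pi stone_cech_mapE FE.
  by rewrite /chi indicE memNset // => Un; apply: nA; exact: Un.
rewrite /= Fp => /(congr1 (@unit_val R)); rewrite !clampE ?lexx ?ler01 // => /eqP.
by rewrite oner_eq0.
Qed.

Lemma section_cluster_connected (P : nat -> set I) :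
  (forall n, connected (P n)) -> connected (section_cluster P).
Proof.
move=> Pc; apply: (@cluster_connected _ u) => //.
- exact: stone_cech_in_continuous.
- exact: stone_cech_hausdorff.
- exact: stone_cech_compact.
(* A fibre part not contained in [F] is replaced by the empty set rather than cut down, which keeps
   every piece connected. *)
move=> F PF; exists (fun n => pair n @` [set x | P n x /\ P n `<=` pair n @^-1` F]).
split=> [n|n _ [x [Px PnF] <-]|U uU]; last 1 first.
- by apply: filterS2 uU PF => n Un Fn x Px; exists n => //; exists x.
- apply: connected_continuous_connected.
    have [PnF|PnF] := pselect (P n `<=` pair n @^-1` F).
      rewrite (_ : mkset _ = P n) //.
      by apply/seteqP; split=> [x []|x].
    rewrite (_ : mkset _ = set0); first exact: connected0.
    by apply/seteqP; split=> // x [].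
  exact/continuous_subspaceT/pair_continuous.
- exact: PnF.
Qed.

Lemma continuum_stone_cech (X : topologicalType) (K : set (stone_cech R X)) :
  K !=set0 -> closed K -> connected K -> continuum K.
Proof.
move=> K0 cK conK; split=> //; last exact/hausdorff_set_type/stone_cech_hausdorff.
exact: subclosed_compact cK (@stone_cech_compact R X) _.
Qed.

Lemma section_cluster_subcontinuum (P : nat -> set I) :
  (forall n, connected (P n)) -> (\forall n \near u, P n !=set0) ->
  subcontinuum (I_u R u) (section_cluster P).
Proof.
move=> Pc P0; split; first exact: section_cluster_I_u.
apply: continuum_stone_cech; last exact: section_cluster_connected.
  apply: cluster_nonempty; first exact: stone_cech_compact.
  apply: fmap_proper_filter; split=> [PF|]; last exact: section_filter_filter.
  by have [n [[x Px] /(_ x Px)]] := filter_ex (filterI P0 PF).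
exact: cluster_closed.
Qed.

Definition initial_section (c : nat -> I) := section_cluster
  (fun n => [set x | unit_val x <= unit_val (c n)]).

Definition final_section (c : nat -> I) := section_cluster
  (fun n => [set x | unit_val (c n) <= unit_val x]).

Lemma initial_section_subcontinuum (c : nat -> I) :
  subcontinuum (I_u R u) (initial_section c).
Proof.
apply: section_cluster_subcontinuum => [n|].
  by apply: unit_connected => x y z _ /= yc /andP[_ zy]; exact: le_trans yc.
by apply: nearW => n; exists (c n) => /=.
Qed.

Lemma I_u_sections (c : nat -> I) :
  I_u R u `<=` initial_section c `|` final_section c.
Proof.
move=> p /I_u_section_cluster pu; apply: section_clusterU.
apply: section_clusterS pu; apply: nearW => n x _ /=.
by case: (leP (unit_val x) (unit_val (c n))) => [|/ltW]; [left|right].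
Qed.

(* The retraction (n, x) |-> (n, min x (c n)) extends to a map that is the
   identity on the initial section and is constant on the final section. *)
Lemma initial_final_section (c : nat -> I) :
  initial_section c `&` final_section c `<=` [set u_limit u c].
Proof.
pose r (z : M) : M := (z.1, clamp (Num.min (unit_val z.2) (unit_val (c z.1)))).
have rc : continuous r.
  apply: bigM_continuous => n x.
  apply: (@continuous_comp _ _ _
    (fun x => clamp (Num.min (unit_val x) (unit_val (c n)))) (pair n)).
    apply: (@continuous_comp _ _ _
      (fun x => Num.min (unit_val x) (unit_val (c n))) (@clamp R)).
      apply: (@continuous_min _ _ (@unit_val R) (fun=> unit_val (c n))).
        exact: unit_val_continuous.
      exact: cst_continuous.
    exact: clamp_continuous.
  exact: pair_continuous.
pose br := stone_cech_map (R := R) (mkcts rc).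
have brE z : br (inM z) = inM (r z) by rewrite /br stone_cech_mapE.
have cbr : continuous br by exact: stone_cech_map_continuous.
move=> p [ip fp].
have <- : br p = p.
  have clp : closure (inM @` [set z : M | unit_val z.2 <= unit_val (c z.1)]) p.
    apply: cluster_subset_closure ip.
    by apply: nearW => n x xc; exists (n, x).
  apply: (@continuous_eq_closure _ _ br id _ (@stone_cech_hausdorff R M) cbr _ _ _
    (mem_set clp)) => [q|]; first exact: cvg_id.
  move=> _ /set_mem [[n x] /= xc <-]; rewrite brE /r /= min_l //.
  by rewrite unit_valK.
apply: (cluster_cvg (@stone_cech_hausdorff R M) _ (@u_limit_cvg c)).
move=> A B cA /cbr pB.
have [|x [Ax Bx]] := fp (br @^-1` A) _ _ pB; last by exists (br x).
rewrite near_section; apply: (@filterS _ u _ (fun n => A (inM (n, c n)))) cA.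
move=> n An x /= cx; rewrite brE /r /= min_r //.
by rewrite unit_valK.
Qed.

(** The initial and final sections at [c] are closed, cover [I_u] and meet at most in [c_u]. If [K]
    missed [c_u], they would split [K] into two disjoint closed pieces, one containing [b_u] and the
    other [p]. *)
Lemma subcontinuum_cut (K : set bM) (b c : nat -> I) (p : bM) :
  subcontinuum (I_u R u) K -> K (u_limit u b) ->
  (\forall n \near u, unit_val (b n) <= unit_val (c n)) ->
  K p -> final_section c p -> K (u_limit u c).
Proof.
move=> [Ku [_ Kc Kconn _]] Kb bc Kp cp; apply: contrapT => nKc.
have sep q : K q -> ~ (initial_section c q /\ final_section c q).
  by move=> Kq /initial_final_section qc; apply: nKc; rewrite -qc.
have BK : K `&` initial_section c = K.
  apply: Kconn.
  - by exists (u_limit u b); split=> //; exact: u_limit_section_cluster.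
  - exists (~` final_section c); first exact/closed_openC/cluster_closed.
    apply/seteqP; split=> q [Kq qc]; split=> //.
      by move=> qf; apply: (sep _ Kq).
    by have [] := I_u_sections c (Ku _ Kq).
  - by exists (initial_section c) => //; exact: cluster_closed.
by apply: (sep _ Kp); split=> //; move: Kp; rewrite -{1}BK => -[].
Qed.

End sections.

(** * The limit layer and its identification with the supremum *)

Section limit_layer.
Variables (R : realType) (u : set_system nat).
Hypotheses (u_ultra : UltraFilter u)
  (u_nonprincipal : forall n : nat, u <> principal_filter n).
Local Notation I := (unit_interval R).
Local Notation M := (bigM R).
Local Notation bM := (stone_cech R M).
Local Notation inM := (@stone_cech_in R M).
Local Notation dyadic := (one_sub_dyadic R).

Definition between (m k : nat) : set I :=
  [set x | unit_val (dyadic m) < unit_val x <= unit_val (dyadic k)].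

(** The exceptional set of [n] may depend on [k]: a member may omit everything beyond a level [t(n)]
    of each fibre, provided [t(n)] tends to infinity along [u]. *)
Definition limit_filter : set_system M := [set F | exists m, forall k,
  \forall n \near u, forall x, between m k x -> F (n, x)].

Lemma betweenS (m m' k : nat) :
  (m <= m')%N -> between m' k `<=` between m k.
Proof.
move=> mm' x /andP[m'x xk]; rewrite /between /= xk andbT.
exact: le_lt_trans (dyadic_le _ mm') m'x.
Qed.

Global Instance limit_filter_proper : ProperFilter limit_filter.
Proof.
split=> [[m /(_ m.+1)]|]; last split.
- by move=> /filter_ex[n /(_ (dyadic m.+1))]; apply; rewrite /between /= dyadic_lt /=.
- by exists 0%N => k; exact: nearW.
- move=> F G [m Fm] [m' Gm']; exists (maxn m m') => k.
  apply: filterS2 (Fm k) (Gm' k) => n Fn Gn x xb; split.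
    by apply: Fn; apply: betweenS xb; rewrite leq_maxl.
  by apply: Gn; apply: betweenS xb; rewrite leq_maxr.
- move=> F G FG [m Fm]; exists m => k; apply: filterS (Fm k) => n Fn x xb.
  by apply: FG; exact: Fn.
Qed.

Definition limit_layer : set bM := cluster (inM @ limit_filter).

Lemma limit_layer_section (P : nat -> set I) (m : nat) :
  (forall k, \forall n \near u, between m k `<=` P n) ->
  limit_layer `<=` section_cluster u P.
Proof.
move=> mP; apply: cvg_cluster => F PF; exists m => k.
have {}PF : \forall n \near u, forall x, P n x -> F (inM (n, x)) by exact: PF.
by apply: filterS2 PF (mP k) => n PF bP x /bP /PF.
Qed.

Lemma limit_layer_I_u : limit_layer `<=` I_u R u.
Proof.
move=> p /(@limit_layer_section (fun=> setT) 0) pT.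
by apply: (section_cluster_I_u u_ultra); apply: pT => k; exact: nearW.
Qed.

Lemma limit_layer_final (m : nat) :
  limit_layer `<=` final_section u (fun=> dyadic m).
Proof.
apply: (@limit_layer_section _ m) => k; apply: nearW => n x /andP[mx _].
exact: ltW.
Qed.

Lemma limit_layer_connected : connected limit_layer.
Proof.
apply: (@cluster_connected _ u) => //.
- exact: stone_cech_in_continuous.
- exact: stone_cech_hausdorff.
- exact: stone_cech_compact.
(* [P n] is the longest piece starting at level [m] that stays in [F]. It is order convex, and for
   each [k] it contains [between m k] for almost every [n]. *)
move=> F [m Fm]; pose P n : set I := [set x | unit_val (dyadic m) < unit_val x /\
  forall y, unit_val (dyadic m) < unit_val y <= unit_val x -> F (n, y)].
exists (fun n => pair n @` P n); split=> [n|n _ [x [mx Px] <-]|U uU].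
- apply: connected_continuous_connected; last first.
    exact/continuous_subspaceT/pair_continuous.
  apply: unit_connected => x y z [mx _] [my Fy] /andP[xz zy].
  split; first exact: lt_le_trans xz.
  by move=> t /andP[mt tz]; apply: Fy; rewrite mt (le_trans tz).
- by apply: Px; rewrite mx lexx.
- exists m => k; apply: filterS2 uU (Fm k) => n Un Fn x /andP[mx xk].
  exists n => //; exists x => //; split=> // y /andP[my yx].
  by apply: Fn; rewrite /between /= my (le_trans yx).
Qed.

Lemma limit_layer_continuum : continuum limit_layer.
Proof.
apply: continuum_stone_cech.
- by apply: cluster_nonempty; exact: stone_cech_compact.
- exact: cluster_closed.
- exact: limit_layer_connected.
Qed.

(** If [K] missed [q], a neighbourhood [V] of [q] with closure off [K] would meet [between 0 k] in
    almost every fibre for some [k]. Points [c n] chosen there give [c_u] in [closure V]; but [c_u]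
    cuts between [0_u] and [p], so it is in [K]. *)
Lemma limit_layer_sub (K : set bM) (p : bM) :
  subcontinuum (I_u R u) K -> K (u_limit u (fun=> unit0 R)) -> K p ->
  limit_layer p -> limit_layer `<=` K.
Proof.
move=> cK K0 Kp Lp q Lq; apply: contrapT => nKq.
have closedK : closed K.
  apply: compact_closed; first exact: stone_cech_hausdorff.
  by case: cK => _ [].
have [V [oV Vq VK]] := closed_separate (@stone_cech_hausdorff R M)
  (@stone_cech_compact R M) closedK nKq.
suff : (inM @ limit_filter) (~` V).
  by move=> /Lq /(_ (open_nbhs_nbhs (conj oV Vq)))[x []].
exists 0%N => k.
have [//|[c nVc]] := @ultra_forall_exists _ _ u
  (fun n x => between 0 k x -> (~` V) (inM (n, x))) u_ultra (unit0 R).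
have ck : \forall n \near u, unit_val (c n) <= unit_val (dyadic k).
  by apply: filterS nVc => n /not_implyP[/andP[]].
have Vc : \forall n \near u, V (inM (n, c n)).
  by apply: filterS nVc => n /not_implyP[_ /contrapT].
have clVc : closure V (u_limit u c).
  move=> W /(u_limit_cvg u_ultra) cW.
  have {}cW : \forall n \near u, W (inM (n, c n)) by exact: cW.
  by have [n [Vn Wn]] := filter_ex (filterI Vc cW); exists (inM (n, c n)).
suff Kc : K (u_limit u c) by have : (closure V `&` K) (u_limit u c) by []; rewrite VK.
apply: (subcontinuum_cut u_ultra cK K0 _ Kp).
  by apply: nearW => n; have /andP[] := unit_val_itv (c n).
have := limit_layer_final (m := k) Lp; apply: section_clusterS.
by apply: filterS ck => n cn x; exact: le_trans.
Qed.

Lemma u_limit_I_u (c : nat -> I) : I_u R u (u_limit u c).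
Proof.
apply: (section_cluster_I_u u_ultra (P := fun=> setT)).
by apply: u_limit_section_cluster => //; exact: nearW.
Qed.

Lemma le_u_limit (b c : nat -> I) :
  (\forall n \near u, unit_val (b n) <= unit_val (c n)) ->
  le_u u (u_limit u b) (u_limit u c).
Proof.
move=> bc K cK K0 Kc; apply: (subcontinuum_cut u_ultra cK K0 _ Kc).
  by apply: nearW => n; have /andP[] := unit_val_itv (b n).
exact: u_limit_section_cluster.
Qed.

(** The initial section is itself a subcontinuum containing [0_u] and [c_u]. *)
Lemma le_u_initial (c : nat -> I) (x : bM) :
  le_u u x (u_limit u c) -> initial_section u c x.
Proof.
move=> /(_ (initial_section u c)); apply.
  exact: initial_section_subcontinuum.
  apply: u_limit_section_cluster; apply: nearW => n /=.
  by have /andP[] := unit_val_itv (c n).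
by apply: u_limit_section_cluster; apply: nearW => n /=.
Qed.

Lemma le_u_trans (x y z : bM) : le_u u x y -> le_u u y z -> le_u u x z.
Proof. by move=> xy yz K cK K0 Kz; apply: xy => //; exact: yz. Qed.

(** The second coordinate extends to [beta M]; the extension is at most [a] on the initial section
    at [a] and at least [b] on the final section at [b]. *)
Lemma initial_section_lt (a b : I) : unit_val a < unit_val b ->
  ~ initial_section u (fun=> a) (u_limit u (fun=> b)).
Proof.
move=> ab ia.
have fb : final_section u (fun=> b) (u_limit u (fun=> b)).
  by apply: u_limit_section_cluster; apply: nearW => n /=.
have csnd : continuous (fun z : M => z.2) by move=> z; exact: cvg_snd.
have [F cF FE'] := stone_cech_extend (mkcts csnd).
have FE n x : F (inM (n, x)) = x by exact: FE'.
have cvF : continuous (@unit_val R \o F).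
  by move=> p; apply: continuous_comp; [exact: cF|exact: unit_val_continuous].
have Fa : unit_val (F (u_limit u (fun=> b))) <= unit_val a.
  have clA : closed ((@unit_val R \o F) @^-1` [set r | r <= unit_val a]).
    by apply: closed_comp => [p _|]; [exact: cvF|exact: closed_le].
  rewrite -/([set r | r <= unit_val a] _); apply: clA.
  apply: cluster_subset_closure ia; rewrite near_section; apply: nearW => n x.
  by rewrite /= FE.
have Fb : unit_val b <= unit_val (F (u_limit u (fun=> b))).
  have clB : closed ((@unit_val R \o F) @^-1` [set r | unit_val b <= r]).
    by apply: closed_comp => [p _|]; [exact: cvF|exact: closed_ge].
  apply: clB.
  apply: cluster_subset_closure fb; rewrite near_section; apply: nearW => n x.
  by rewrite /= FE.
by have := lt_le_trans ab (le_trans Fb Fa); rewrite ltxx.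
Qed.

(* For A in the filter with witness m, the point given by the largest k n <= n
   with between m (k n) inside the n-th fibre of A bounds the sequence. *)
Lemma is_layer_sup_sub (L : set bM) :
  is_layer_sup u (fun m => layer u (u_limit u (fun=> dyadic m))) L ->
  L `<=` limit_layer.
Proof.
move=> [_ Lub Lleast] z Lz A B [m Am] zB; apply: contrapT => AB.
pose good n k := forall x, between m k x -> A (inM (n, x)).
pose k n := \max_(j < n.+1 | `[< good n j >]) j.
(* Index 0 is always admissible because [between m 0] is empty; this settles the initial value of
   the maximum. *)
have kgood n : good n (k n).
  rewrite /k; elim/big_ind: _ => [x /andP[mx x0]|i j gi gj|i /asboolP //].
    by have := lt_le_trans mx (le_trans x0 (dyadic_le _ (leq0n m))); rewrite ltxx.
  by rewrite /maxn; case: ifP.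
have kge j : \forall n \near u, (j <= k n)%N.
  apply: filterS2 (nonprincipal_ge u_ultra u_nonprincipal j) (Am j) => n jn gj.
  rewrite -ltnS in jn.
  by apply: (@leq_bigmax_cond _ _ _ (Ordinal jn)); apply/asboolP.
pose y := u_limit u (fun n => dyadic (k n)).
have Ly : layer_le u L (layer u y).
  apply: Lleast; first by exists y => //; exact: u_limit_I_u.
  move=> j a b [_ [_ aj]] [_ [yb _]]; apply: le_u_trans aj (le_u_trans _ yb).
  by apply: le_u_limit; apply: filterS (kge j) => n; exact: dyadic_le.
have zy : initial_section u (fun n => dyadic (k n)) z.
  apply: le_u_initial; apply: Ly => //; split; first exact: u_limit_I_u.
  by split.
(* Up to level [k n], a point is either at most level [m] or in [between m (k n)], hence in [A]; the
   latter points cannot cluster at [z], since [B] misses [A]. *)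
have zm : initial_section u (fun=> dyadic m) z.
  have : section_cluster u (fun n =>
      [set x : I | unit_val x <= unit_val (dyadic m)] `|` between m (k n)) z.
    move: zy; apply: section_clusterS; apply: nearW => n x /= xk.
    by rewrite /between /= xk andbT; case: leP => _; [left|right].
  move=> /(section_clusterU u_ultra)[//|zb]; case: AB; apply: zb zB.
  by rewrite near_section; apply: nearW.
(* As [z] is above the point of level [m.+1], the initial section at level [m], a subcontinuum
   containing [0_u] and [z], would contain that point too. *)
have := @initial_section_lt (dyadic m) (dyadic m.+1) (dyadic_lt _ (ltnSn m)).
apply; apply: (Lub m.+1 _ z _ Lz _ _ _ zm).
- by split; [exact: u_limit_I_u|split].
- exact: initial_section_subcontinuum.
apply: u_limit_section_cluster; apply: nearW => n /=.
by have /andP[] := unit_val_itv (dyadic m).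
Qed.

(** [L] contains its representative [x], which therefore lies in the limit layer; by
    [limit_layer_sub] all points of the limit layer are equivalent to [x]. *)
Lemma is_layer_sup_limit (L : set bM) :
  is_layer_sup u (fun m => layer u (u_limit u (fun=> dyadic m))) L ->
  L = limit_layer.
Proof.
move=> supL; have LL := is_layer_sup_sub supL; apply/seteqP; split=> // p Lp.
case: supL => -[x xu Lx] _ _.
have limx : limit_layer x by apply: LL; rewrite Lx; split=> //; split.
rewrite Lx; split; first exact: limit_layer_I_u.
by split=> K cK K0 Kq; [apply: (limit_layer_sub cK K0 Kq Lp)|
  apply: (limit_layer_sub cK K0 Kq limx)].
Qed.

End limit_layer.

(** * The translation of the limit layer and its graph *)

Section shift.
Variables (R : realType) (u : set_system nat).
Hypotheses (u_ultra : UltraFilter u)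
  (u_nonprincipal : forall n : nat, u <> principal_filter n).
Local Notation I := (unit_interval R).
Local Notation M := (bigM R).
Local Notation bM := (stone_cech R M).
Local Notation inM := (@stone_cech_in R M).
Local Notation dyadic := (one_sub_dyadic R).

Definition midpoint1 (x : I) : I := clamp ((1 + unit_val x) / 2).

Lemma midpoint1E (x : I) : unit_val (midpoint1 x) = (1 + unit_val x) / 2.
Proof. by rewrite clampE //; have := unit_val_itv x; lra. Qed.

Lemma dyadicS (m : nat) :
  unit_val (dyadic m.+1) = (1 + unit_val (dyadic m)) / 2.
Proof. by rewrite !unit_val_dyadic exprS invfM; field. Qed.

Definition shift_fun (z : M) : M := (z.1, midpoint1 z.2).

Lemma shift_fun_continuous : continuous shift_fun.
Proof.
have cmid : continuous (fun x : I => (1 + unit_val x) / 2).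
  move=> x; have FF : Filter (nbhs x) by exact: nbhs_filter.
  apply: cvgM; last exact: cvg_cst.
  by apply: cvgD; [exact: cvg_cst|exact: unit_val_continuous].
apply: bigM_continuous => n x.
apply: (@continuous_comp _ _ _ midpoint1 (pair n)); last exact: pair_continuous.
by apply: continuous_comp; [exact: cmid|exact: clamp_continuous].
Qed.

Definition shift : bM -> bM := stone_cech_map (mkcts shift_fun_continuous).

Lemma shift_continuous : continuous shift.
Proof. exact: stone_cech_map_continuous. Qed.

Lemma shiftE (n : nat) (x : I) : shift (inM (n, x)) = inM (n, midpoint1 x).
Proof. by rewrite /shift stone_cech_mapE. Qed.

Lemma limit_filter_shift (F : set M) :
  limit_filter u (shift_fun @^-1` F) = limit_filter u F.
Proof.
apply/propext; split=> -[m Fm].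
  (* Beyond level [m.+1], [y] is the image of [2 * y - 1], which is beyond level [m] and, being at
     most [y], still within level [k]. *)
  exists m.+1 => k; apply: filterS (Fm k) => n Fn y.
  rewrite /between /= dyadicS => /andP[my yk].
  have y01 := unit_val_itv y; have m01 := unit_val_itv (dyadic m).
  have x01 : 0 <= 2 * unit_val y - 1 <= 1 by lra.
  have -> : (n, y) = shift_fun (n, clamp (2 * unit_val y - 1)).
    congr pair; apply: unit_val_inj; rewrite midpoint1E clampE //; lra.
  by apply: Fn; rewrite /between /= clampE //; lra.
(* The midpoint map raises the upper level by one, hence [k.+1]; the lower bound [m] survives
   because the map is increasing in level. *)
exists m => k; apply: filterS (Fm k.+1) => n Fn x.
rewrite /between /= => /andP[mx xk]; apply: Fn => /=.
rewrite /between /= midpoint1E dyadicS; have := unit_val_itv x; lra.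
Qed.

(** By compactness the image of the cluster set is the cluster set of the image filter, and that
    filter is invariant. *)
Lemma shift_limit_layer : shift @` limit_layer u = limit_layer u.
Proof.
rewrite image_cluster.
- congr cluster; apply/funext => A.
  rewrite -[RHS]/(limit_filter u (inM @^-1` A)) -limit_filter_shift.
  rewrite -[LHS]/(limit_filter u (inM @^-1` (shift @^-1` A))); congr limit_filter.
  by apply/seteqP; split=> -[n x] /=; rewrite shiftE.
- exact: stone_cech_compact.
- exact: stone_cech_compact.
- exact: stone_cech_hausdorff.
- exact: shift_continuous.
Qed.

(* Halving 1 - x lowers its base-2 logarithm by 1; the truncation at 2^-n makes
   the logarithm continuous on the whole n-th interval. *)
Definition phase (n : nat) (x : I) : R :=
  pi * (- ln (Num.max (1 - unit_val x) (2 ^- n)) / ln 2).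

Lemma phase_continuous (n : nat) : continuous (phase n).
Proof.
move=> x; have FF : Filter (nbhs x) by exact: nbhs_filter.
apply: cvgM; first exact: cvg_cst.
apply: cvgM; last exact: cvg_cst.
apply: cvgN.
apply: (@continuous_comp _ _ _ (fun x => Num.max (1 - unit_val x) (2 ^- n)) (@ln R)).
  apply: (@continuous_max _ _ (fun x => 1 - unit_val x) (fun=> 2 ^- n)).
    by apply: cvgB; [exact: cvg_cst|exact: unit_val_continuous].
  exact: cst_continuous.
by apply: continuous_ln; rewrite lt_max invr_gt0 exprn_gt0 ?orbT.
Qed.

(** The hypothesis makes the truncation inactive both at [x] and at its image. *)
Lemma phase_midpoint1 (n : nat) (x : I) :
  2 ^- n <= (1 - unit_val x) / 2 -> phase n (midpoint1 x) = phase n x + pi.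
Proof.
move=> nx; have n0 : (0 : R) < 2 ^- n by rewrite invr_gt0 exprn_gt0.
have ln2 : ln (2 : R) != 0 by rewrite gt_eqF // ln_gt0 // ltr1n.
rewrite /phase midpoint1E max_l; last lra.
rewrite max_l; last lra.
have -> : 1 - (1 + unit_val x) / 2 = (1 - unit_val x) / 2 by field.
by rewrite ln_div ?posrE //; [field|lra].
Qed.

Lemma phase_extend (f : R -> R) :
  continuous f -> (forall r, -1 <= f r <= 1) -> (forall r, f (r + pi) = - f r) ->
  exists F : bM -> R, [/\ continuous F,
    forall n x, F (inM (n, x)) = f (phase n x) &
    {in limit_layer u, forall p, F (shift p) = - F p}].
Proof.
move=> cf f1 fpi.
(* The values are rescaled from [[-1,1]] to [[0,1]], where the extension property applies; [F]
   undoes this. *)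
pose g (z : M) : I := clamp ((1 + f (phase z.1 z.2)) / 2).
have gE z : unit_val (g z) = (1 + f (phase z.1 z.2)) / 2.
  by rewrite clampE //; have := f1 (phase z.1 z.2); lra.
have cfn n : continuous (fun x : I => (1 + f (phase n x)) / 2).
  move=> x; have FF : Filter (nbhs x) by exact: nbhs_filter.
  apply: cvgM; last exact: cvg_cst.
  apply: cvgD; first exact: cvg_cst.
  by apply: continuous_comp; [exact: phase_continuous|exact: cf].
have cg : continuous g.
  apply: bigM_continuous => n x.
  apply: (@continuous_comp _ _ _ (fun x => (1 + f (phase n x)) / 2) (@clamp R)).
    exact: cfn.
  exact: clamp_continuous.
have [G cG GE'] := stone_cech_extend (mkcts cg).
have GE z : G (inM z) = g z by exact: GE'.
pose F p := 2 * unit_val (G p) - 1.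
have cF : continuous F.
  move=> p; have FF : Filter (nbhs p) by exact: nbhs_filter.
  apply: cvgB; last exact: cvg_cst.
  apply: cvgM; first exact: cvg_cst.
  apply: (@continuous_comp _ _ _ G (@unit_val R)); first exact: cG.
  exact: unit_val_continuous.
have FE n x : F (inM (n, x)) = f (phase n x) by rewrite /F GE gE /=; field.
exists F; split=> // p /set_mem Lp.
(* The phase identity holds on [A]. For [n > k] the part [between 0 k] of fibre [n] lies in [A], so
   the layer is in the closure of [A]. *)
pose A := [set z : M | 2 ^- z.1 <= (1 - unit_val z.2) / 2].
have clp : closure (inM @` A) p.
  apply: cluster_subset_closure Lp; exists 0%N => k.
  apply: filterS (nonprincipal_ge u_ultra u_nonprincipal k.+1) => n kn x.
  move=> /andP[_ xk]; exists (n, x) => //; rewrite /A /=.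
  move: xk (dyadic_le R kn); rewrite dyadicS !unit_val_dyadic; lra.
apply: (@continuous_eq_closure _ _ (F \o shift) (fun p => - F p) _ (@Rhausdorff R)
  _ _ _ _ (mem_set clp)).
- by move=> q; apply: continuous_comp; [exact: shift_continuous|exact: cF].
- by move=> q; have FF : Filter (nbhs q) by [exact: nbhs_filter]; apply: cvgN; exact: cF.
by move=> _ /set_mem[[n x] nx <-]; rewrite /= shiftE !FE phase_midpoint1 ?fpi.
Qed.

(** At a fixed point the extended cosine and sine equal their own negatives and vanish, although
    their squares sum to 1 on all of [beta M] by density. *)
Lemma shift_fixpoint_free (p : bM) : limit_layer u p -> shift p <> p.
Proof.
move=> Lp pp.
have [C [cC CE Cp]] := phase_extend (@continuous_cos R)
  (fun r => introT andP (conj (cos_geN1 r) (cos_le1 r))) (@cosDpi R).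
have [S [cS SE Sp]] := phase_extend (@continuous_sin R)
  (fun r => introT andP (conj (sin_geN1 r) (sin_le1 r))) (@sinDpi R).
have CS : C p ^+ 2 + S p ^+ 2 = 1.
  have clp : closure (range inM) p by rewrite stone_cech_in_dense.
  apply: (@continuous_eq_closure _ _ (fun q => C q ^+ 2 + S q ^+ 2) (fun=> 1) _
    (@Rhausdorff R) _ _ _ _ (mem_set clp)).
  - move=> q; have FF : Filter (nbhs q) by exact: nbhs_filter.
    by apply: cvgD; apply: cvgM; first [exact: cC|exact: cS].
  - exact: cst_continuous.
  by move=> _ /set_mem[[n x] _ <-]; rewrite CE SE cos2Dsin2.
have := Cp p (mem_set Lp); have := Sp p (mem_set Lp); rewrite pp => Sp0 Cp0.
have C0 : C p = 0 by lra.
have S0 : S p = 0 by lra.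
by move: CS; rewrite C0 S0 expr0n /= addr0 => /eqP; rewrite eq_sym oner_eq0.
Qed.

Definition shift_graph : set (bM * bM) := (fun p => (p, shift p)) @` limit_layer u.

Lemma fst_shift_graph : fst @` shift_graph = limit_layer u.
Proof. by rewrite image_comp image_id. Qed.

Lemma snd_shift_graph : snd @` shift_graph = limit_layer u.
Proof. by rewrite image_comp -[RHS]shift_limit_layer. Qed.

Lemma shift_graph_continuum : continuum shift_graph.
Proof.
have cgr : continuous (fun p => (p, shift p)).
  move=> p A [[B C] /= [Bp Cp] BC].
  have BCp : nbhs p (B `&` shift @^-1` C).
    by apply: filterI => //; exact: shift_continuous.
  by apply: filterS BCp => q [Bq Cq]; exact: BC.
have [[p Lp] cL connL _] := limit_layer_continuum R u_ultra.
split.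
- by exists (p, shift p); exists p.
- by apply: continuous_compact => //; exact: continuous_subspaceT.
- by apply: connected_continuous_connected => //; exact: continuous_subspaceT.
(* The first projection is injective on a graph, so the Hausdorff property comes from [beta M]. *)
apply: (@injective_hausdorff _ _ (fst \o set_val)); last exact: stone_cech_hausdorff.
  move=> [a /[dup] /set_mem [x _ <-] ax] [b /[dup] /set_mem [y _ <-] bx] /= xy.
  by apply: val_inj => /=; rewrite xy.
move=> a; apply: continuous_comp; first exact: initial_continuous.
exact: cvg_fst.
Qed.

Lemma shift_graph_diagonal (X : set bM) : shift_graph `&` Defs.diagonal X = set0.
Proof.
apply/disjoints_subset => _ [p Lp <-] [_ /= pp].
exact: (shift_fixpoint_free Lp).
Qed.

Lemma shift_graph_sub : shift_graph `<=` limit_layer u `*` limit_layer u.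
Proof.
move=> _ [p Lp <-]; split=> //=; rewrite -shift_limit_layer; exact: imageP.
Qed.

End shift.

Theorem corollary4p2 (R : realType) (u : set_system nat)
    (u_ultra : UltraFilter u)
    (u_nonprincipal : forall n : nat, u <> principal_filter n) :
  (forall L : set (stone_cech R (bigM R)),
     is_layer_sup u (fun m => layer u (u_limit u (fun=> one_sub_dyadic R m))) L ->
     surjective_span_nonzero L) /\
  span_nonzero (I_u R u).
Proof.
split=> [L /(is_layer_sup_limit u_ultra u_nonprincipal) ->|].
  exists (shift_graph u); split; last exact: shift_graph_diagonal.
  - by split; [exact: shift_graph_sub|exact: shift_graph_continuum].
  - exact: fst_shift_graph.
  - exact: snd_shift_graph.
exists (shift_graph u); split; last exact: shift_graph_diagonal.
- split; last exact: shift_graph_continuum.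
  by move=> p /shift_graph_sub[L1 L2]; split; exact: (limit_layer_I_u u_ultra).
- by rewrite fst_shift_graph snd_shift_graph.
Qed.
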